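(* If $\mathbb{B}$ is a Borel Boolean algebra, then $\mathbf{R}({}^\omega\mathbb{B}/\mathrm{Fin})$ is a Borel relational system. If, in addition, $\mathbb{B}$ is Borel-homogeneous, then $\diamondsuit(\mathbf{R}({}^\omega\mathbb{B}/\mathrm{Fin}))$ implies $\mathfrak{u}({}^\omega\mathbb{B}/\mathrm{Fin})=\aleph_1$.
   Context: A Boolean algebra $\mathbb{B}$ is Borel if its domain is a Borel subset of ${}^\omega2$ and its order relation $\le$ and incompatibility relation $\perp$ are Borel subsets of ${}^\omega2\times{}^\omega2$. It is Borel-homogeneous if it is Borel, the meet $\wedge\colon\mathbb{B}\times\mathbb{B}\to\mathbb{B}$ is a Borel function, and for each $b\in\mathbb{B}^+=\mathbb{B}\setminus\{\mathbb0\}$ the relative algebra $\mathbb{B}\restriction b=\{c\in\mathbb{B}:c\le b\}$ is isomorphic to $\mathbb{B}$ via a Borel function. Reduced power: ${}^\omega\mathbb{B}$ with pointwise operations, $\mathrm{Fin}=\{f:\{n:f(n)>\mathbb0\}\text{ finite}\}$, quotient ${}^\omega\mathbb{B}/\mathrm{Fin}$ with classes $[f]$. The reaping relation of a Boolean algebra $\mathbb{A}$ is $\mathbf{R}(\mathbb{A})=\langle\mathbb{A},R,\mathbb{A}^+\rangle$ with $b\,R\,r$ iff $r\le b$ or $r\wedge b=\mathbb0$; for ${}^\omega\mathbb{B}/\mathrm{Fin}$ it is realized on representatives: first coordinate in ${}^\omega\mathbb{B}$, second in ${}^\omega\mathbb{B}\setminus\mathrm{Fin}$ (subsets of the Polish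 space $({}^\omega2)^\omega$), with $f\,R\,g$ iff $[f]\,R\,[g]$. A relational system $\mathbf{A}=\langle A_-,A,A_+\rangle$ is Borel if $A_-,A,A_+$ are Borel subsets of some Polish space, every $x\in A_-$ is related to some $y\in A_+$, and every $y\in A_+$ is unrelated to some $x\in A_-$. For Borel $\mathbf{A}$, $\diamondsuit(\mathbf{A})$ states: for every Borel $F\colon{}^{<\omega_1}2\to A_-$ (each $F\restriction{}^\delta2$, $\delta<\omega_1$, Borel) there is $g\colon\omega_1\to A_+$ such that for every $f\colon\omega_1\to2$ the set $\{\alpha<\omega_1:\langle F(f\restriction\alpha),g(\alpha)\rangle\in A\}$ is stationary. For an infinite Boolean algebra $\mathbb{A}$, $\mathfrak{u}(\mathbb{A})$ is the minimum over non-principal ultrafilters $U$ on $\mathbb{A}$ of the cofinality of $\langle U,\ge\rangle$. *)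

(* Defs.v *)
From HB Require Import structures.
From mathcomp Require Import all_boot all_order all_algebra.
From mathcomp Require Import generic_quotient.
From mathcomp Require Import boolp classical_sets functions cardinality.
From mathcomp Require Import wochoice reals topology cantor measurable_structure.

Set Implicit Arguments.
Unset Strict Implicit.
Unset Printing Implicit Defensive.

Import Order.Theory GRing.Theory Num.Theory.

Local Open Scope classical_set_scope.
Local Open Scope card_scope.
Local Open Scope order_scope.

Definition borel (T : topologicalType) : set (set T) := <<s @open T >>.
Arguments borel {T}.

Definition borel_fun (X Y : topologicalType) (f : X -> Y) : Prop :=
  forall C : set Y, borel C -> borel (f @^-1` C).

(* A partial function between Borel subsets of X and Y, presented as
   h : S -> U where the injections cS : S -> X and cU : U -> Y identify S and U
   with the Borel sets [range cS] and [range cU]. *)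
Definition coded_borel_fun (X Y : topologicalType) (S U : Type)
    (cS : S -> X) (cU : U -> Y) (h : S -> U) : Prop :=
  forall C : set Y, borel C -> borel (cS @` [set s | C (cU (h s))]).

Section polish.
Local Open Scope ring_scope.
Variables (R : realType) (T : topologicalType).

Definition is_metric (dist : T -> T -> R) : Prop :=
  [/\ forall x y, dist x y = 0 <-> x = y,
      forall x y, dist x y = dist y x &
      forall x y z, dist x z <= dist x y + dist y z].

Definition metric_induces_topology (dist : T -> T -> R) : Prop :=
  forall x (U : set T),
    nbhs x U <-> exists2 e : R, 0 < e & [set y | dist x y < e] `<=` U.

Definition metric_complete (dist : T -> T -> R) : Prop :=
  forall u : nat -> T,
    (forall e : R, 0 < e -> exists N, forall m n,
       (N <= m)%N -> (N <= n)%N -> dist (u m) (u n) < e) ->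
    exists l : T, u @ \oo --> l.

Definition polish : Prop :=
  (exists2 D : set T, countable D & dense D) /\
  exists dist : T -> T -> R,
    [/\ is_metric dist, metric_induces_topology dist & metric_complete dist].

End polish.

(* The first uncountable ordinal, realized as the set of those points of a
   well-ordering of 2^omega that have countably many predecessors. *)

Definition cantor_wo : rel cantor_space :=
  sval (well_ordering_principle cantor_space).

Definition omega1 : Type :=
  {x : cantor_space | `[< countable [set y | cantor_wo y x && (y != x)] >]}.

HB.instance Definition _ := SubChoice.on omega1.

Section omega1_order.

Let wo : well_order cantor_wo.
Proof. exact: (svalP (well_ordering_principle cantor_space)). Qed.

Let woT : wo_chain cantor_wo predT.
Proof. exact: (withinW (A := predT) wo). Qed.

Let wo_min (A : set cantor_space) : A !=set0 ->
  exists2 z, A z & forall x, A x -> cantor_wo z x.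
Proof.
move=> [a Aa]; have [|z [[/asboolP Az lbz] _]] := @wo (fun x => `[< A x >]).
  by exists a; apply/asboolP.
by exists z => // x Ax; apply: lbz; apply/asboolP.
Qed.

Let wo_refl x : cantor_wo x x.
Proof. exact: (wo_chain_reflexive woT). Qed.

Let wo_anti x y : cantor_wo x y -> cantor_wo y x -> x = y.
Proof. by move=> xy yx; apply: (wo_chain_antisymmetric woT) => //; rewrite xy. Qed.

Let wo_total x y : cantor_wo x y || cantor_wo y x.
Proof. exact: (wo_chainW woT). Qed.

Let wo_trans y x z : cantor_wo x y -> cantor_wo y z -> cantor_wo x z.
Proof.
move=> xy yz; have [|w] := @wo_min [set x; y; z]; first by exists x; left; left.
move=> [[->|->]|->] lb; first by apply: lb; right.
- by rewrite (wo_anti xy) //; apply: lb; left; left.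
- by rewrite (@wo_anti y z) // in xy *; apply: lb; left; right.
Qed.

Definition omega1_le (x y : omega1) : bool := cantor_wo (val x) (val y).

Fact omega1_le_refl : reflexive omega1_le.
Proof. by move=> x; exact: wo_refl. Qed.

Fact omega1_le_anti : antisymmetric omega1_le.
Proof. by move=> x y /andP[xy yx]; apply: val_inj; exact: wo_anti. Qed.

Fact omega1_le_trans : transitive omega1_le.
Proof. by move=> y x z; exact: wo_trans. Qed.

Fact omega1_display : Order.disp_t. Proof. exact: Order.Disp tt tt. Qed.

HB.instance Definition _ := Order.Le_isPOrder.Build omega1_display omega1
  omega1_le_refl omega1_le_anti omega1_le_trans.

Fact omega1_le_total : total (<=%O : rel omega1).
Proof. by move=> x y; exact: wo_total. Qed.

HB.instance Definition _ :=
  Order.POrder_isTotal.Build omega1_display omega1 omega1_le_total.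

(* The next three facts characterize omega1 up to order isomorphism. *)

Lemma omega1_min (A : set omega1) : A !=set0 ->
  exists2 z, A z & forall x, A x -> z <= x.
Proof.
move=> [a Aa]; have [|z [z' Az' <-] lbz] := @wo_min (val @` A).
  by exists (val a), a.
by exists z' => // x Ax; apply: lbz; exists x.
Qed.

Lemma omega1_countable_segment (x : omega1) : countable [set y | y < x].
Proof.
have /asboolP cx := valP x.
apply: (@sub_countable _ _ _ 
  [set y : cantor_space | cantor_wo y (val x) && (y != val x)]) cx.
apply/pcard_leP/injfunPex => /=; exists val.
- by move=> y /=; rewrite lt_neqAle andbC.
- by move=> ? ? _ _; exact: val_inj.
Qed.

Lemma omega1_uncountable : ~ countable [set: omega1].
Proof.
move=> cT; pose S := [set x : cantor_space | countable [set y | cantor_wo y x && (y != x)]].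
have cS : countable S.
  have -> : S = val @` [set: omega1].
    apply/seteqP; split=> [x Sx|_ [x _ <-]]; last by have /asboolP := valP x.
    have Sx' : `[< countable [set y | cantor_wo y x && (y != x)] >] by apply/asboolP.
    by exists (exist _ x Sx').
  by apply: sub_countable cT; exact: card_image_le.
have [S0|/set0P/wo_min[z /= nSz lbz]] := eqVneq (~` S)%classic set0.
  have : countable [set: cantor_space].
    by apply: sub_countable cS; apply: subset_card_le => x _;
      apply: contrapT => nSx; have : (~` S)%classic x by []; rewrite S0.
  move=> /countable_injP[f /(_ _ _ (mem_setT _) (mem_setT _)) finj].
  pose D : cantor_space := fun n => `[< exists2 x, f x = n & ~~ x n >].
  have [DfD|nDfD] := boolP (D (f D)); last first.
    by case/negP: (nDfD); apply/asboolP; exists D.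
  by have /asboolP[x /finj xD] := DfD; rewrite xD DfD.
apply: nSz; apply: sub_countable cS; apply: subset_card_le => y /andP[yz yNz].
apply: contrapT => nSy; move/eqP: yNz; apply; apply: wo_anti => //.
exact: lbz.
Qed.

End omega1_order.

Definition omega1_unbounded (C : set omega1) : Prop :=
  forall a, exists2 c, C c & a < c.

Definition omega1_limit (a : omega1) : Prop :=
  (exists b, b < a) /\ forall b, b < a -> exists2 c, b < c & c < a.

Definition omega1_closed (C : set omega1) : Prop :=
  forall a, omega1_limit a ->
    (forall b, b < a -> exists2 c, C c & b < c < a) -> C a.

Definition club (C : set omega1) : Prop := omega1_unbounded C /\ omega1_closed C.

Definition stationary (S : set omega1) : Prop :=
  forall C, club C -> exists2 a, C a & S a.

Record relsys := RelSys {
  rs_space : topologicalType;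
  rs_chal : set rs_space;
  rs_rel : set (rs_space * rs_space);
  rs_resp : set rs_space }.
Arguments rs_chal : clear implicits.
Arguments rs_rel : clear implicits.
Arguments rs_resp : clear implicits.

Definition borel_relsys (R : realType) (A : relsys) : Prop :=
  [/\ polish R (rs_space A),
      [/\ borel (rs_chal A), borel (rs_rel A) & borel (rs_resp A)],
      forall x, rs_chal A x -> exists2 y, rs_resp A y & rs_rel A (x, y) &
      forall y, rs_resp A y -> exists2 x, rs_chal A x & ~ rs_rel A (x, y)].

Definition two_pow (a : omega1) : topologicalType :=
  prod_topology (fun _ : {b : omega1 | b < a} => bool).

Definition seg_restr (f : omega1 -> bool) (a : omega1) : two_pow a :=
  fun b => f (sval b).
Arguments seg_restr : clear implicits.

Definition diamond (A : relsys) : Prop :=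
  forall F : forall a : omega1, two_pow a -> rs_space A,
    (forall a, borel_fun (F a)) ->
    (forall a t, rs_chal A (F a t)) ->
    exists2 g : omega1 -> rs_space A,
      (forall a, rs_resp A (g a)) &
      forall f : omega1 -> bool,
        stationary [set a | rs_rel A (F a (seg_restr f a), g a)].

Section fun_algebra.
Variables (aT : Type) (d : Order.disp_t) (B : ctbDistrLatticeType d).
Implicit Types f g h : aT -> B.

Fact fun_meetUl :
  @left_distributive (aT -> B) (aT -> B) Order.meet Order.join.
Proof. by move=> f g h; apply/funext => x; exact: meetUl. Qed.

HB.instance Definition _ := Order.Lattice_Meet_isDistrLattice.Build
  FunOrder.fun_display (aT -> B) fun_meetUl.

Fact fun_le0 f : (fun=> \bot) <= f.
Proof. by apply/lefP => x; exact: le0x. Qed.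

Fact fun_le1 f : f <= (fun=> \top).
Proof. by apply/lefP => x; exact: lex1. Qed.

HB.instance Definition _ := Order.hasBottom.Build
  FunOrder.fun_display (aT -> B) fun_le0.
HB.instance Definition _ := Order.hasTop.Build
  FunOrder.fun_display (aT -> B) fun_le1.

Definition fun_compl f : aT -> B := fun x => ~` f x.

Fact fun_joinxC f : f `|` fun_compl f = \top.
Proof. by apply/funext => x; exact: joinxC. Qed.

Fact fun_meetxC f : f `&` fun_compl f = \bot.
Proof. by apply/funext => x; exact: meetxC. Qed.

HB.instance Definition _ := Order.TBDistrLattice_hasComplement.Build
  FunOrder.fun_display (aT -> B) fun_joinxC fun_meetxC.

End fun_algebra.

Record ideal (d : Order.disp_t) (A : ctbDistrLatticeType d) := Ideal {
  ideal_set :> A -> Prop;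
  ideal0 : ideal_set \bot;
  ideal_down : forall x y, x <= y -> ideal_set y -> ideal_set x;
  idealU : forall x y, ideal_set x -> ideal_set y -> ideal_set (x `|` y) }.

Section quotient_algebra.
Variables (d : Order.disp_t) (A : ctbDistrLatticeType d) (I : ideal A).
Implicit Types x y z : A.

Definition ideal_equiv : rel A :=
  fun x y => `[< I ((x `\` y) `|` (y `\` x)) >].

Let equivP x y : reflect (exists2 i, I i & x `|` i = y `|` i) (ideal_equiv x y).
Proof.
apply: (iffP (asboolP _)) => [Ixy|[i Ii xy]].
  exists ((x `\` y) `|` (y `\` x)) => //.
  rewrite [LHS]joinCA diffKU joinCA diffUK [RHS]joinA diffKU -joinA diffKU.
  by rewrite joinA joinxx joinCA joinxx.
apply: ideal_down Ii; rewrite leUx !leBLR.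
by rewrite -xy leUl xy leUl.
Qed.

Fact ideal_equiv_refl : reflexive ideal_equiv.
Proof. by move=> x; apply/equivP; exists \bot => //; exact: ideal0. Qed.

Fact ideal_equiv_sym : symmetric ideal_equiv.
Proof.
by move=> x y; apply/equivP/equivP => -[i Ii xy]; exists i; rewrite // xy.
Qed.

Fact ideal_equiv_trans : transitive ideal_equiv.
Proof.
move=> y x z /equivP[i Ii xy] /equivP[j Ij yz]; apply/equivP.
exists (i `|` j); first exact: idealU.
by rewrite joinA xy joinAC yz joinAC joinA.
Qed.

Canonical ideal_equiv_rel :=
  EquivRel ideal_equiv ideal_equiv_refl ideal_equiv_sym ideal_equiv_trans.

Definition quotient_algebra : Type := {eq_quot ideal_equiv}%qT.

HB.instance Definition _ := Choice.on quotient_algebra.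

Definition qclass (x : A) : quotient_algebra := (\pi_({eq_quot ideal_equiv}) x)%qT.

Let qrepr (u : quotient_algebra) : A := repr (u : {eq_quot ideal_equiv}%qT).

Let qreprK u : qclass (qrepr u) = u.
Proof. exact: reprK. Qed.

Let qclass_eq x y : qclass x = qclass y <-> ideal_equiv x y.
Proof. exact: (rwP (eqquotP _ x y)). Qed.

Let qreprP x : exists2 i, I i & qrepr (qclass x) `|` i = x `|` i.
Proof. by apply/equivP; apply: (iffLR (qclass_eq _ _)); exact: qreprK. Qed.

Definition qmeet (u v : quotient_algebra) := qclass (qrepr u `&` qrepr v).
Definition qjoin (u v : quotient_algebra) := qclass (qrepr u `|` qrepr v).
Definition qcompl (u : quotient_algebra) := qclass (~` qrepr u).

Let pi_meet x y : qmeet (qclass x) (qclass y) = qclass (x `&` y).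
Proof.
have [[i Ii xi] [j Ij yj]] := (qreprP x, qreprP y).
apply: (iffRL (qclass_eq _ _)); apply/equivP; exists (i `|` j); first exact: idealU.
rewrite !joinIl; congr (_ `&` _); first by rewrite !joinA xi.
by rewrite !joinA ![_ `|` i `|` j]joinAC yj.
Qed.

Let pi_join x y : qjoin (qclass x) (qclass y) = qclass (x `|` y).
Proof.
have [[i Ii xi] [j Ij yj]] := (qreprP x, qreprP y).
apply: (iffRL (qclass_eq _ _)); apply/equivP; exists (i `|` j); first exact: idealU.
by rewrite joinACA xi yj joinACA.
Qed.

Let pi_compl x : qcompl (qclass x) = qclass (~` x).
Proof.
have [i Ii xi] := qreprP x; apply: (iffRL (qclass_eq _ _)); apply/equivP; exists i => //.
have ji z : ~` z `|` i = ~` (z `|` i) `|` i.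
  by rewrite complU joinIl joinCx meetx1.
by rewrite ji xi -ji.
Qed.

Let quotW (P : quotient_algebra -> Prop) : (forall x, P (qclass x)) -> forall u, P u.
Proof. by move=> PA u; rewrite -(qreprK u). Qed.

Definition qle (u v : quotient_algebra) : bool := qmeet u v == u.
Definition qlt (u v : quotient_algebra) : bool := (v != u) && qle u v.

Fact qle_def u v : qle u v = (qmeet u v == u). Proof. by []. Qed.
Fact qlt_def u v : qlt u v = (v != u) && qle u v. Proof. by []. Qed.

Fact qmeetC : commutative qmeet.
Proof. by elim/quotW=> x; elim/quotW=> y; rewrite !pi_meet meetC. Qed.

Fact qjoinC : commutative qjoin.
Proof. by elim/quotW=> x; elim/quotW=> y; rewrite !pi_join joinC. Qed.

Fact qmeetA : associative qmeet.
Proof.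
by elim/quotW=> x; elim/quotW=> y; elim/quotW=> z; rewrite !pi_meet meetA.
Qed.

Fact qjoinA : associative qjoin.
Proof.
by elim/quotW=> x; elim/quotW=> y; elim/quotW=> z; rewrite !pi_join joinA.
Qed.

Fact qjoinKI v u : qmeet u (qjoin u v) = u.
Proof.
by elim/quotW: u => x; elim/quotW: v => y; rewrite pi_join pi_meet joinKI.
Qed.

Fact qmeetKU v u : qjoin u (qmeet u v) = u.
Proof.
by elim/quotW: u => x; elim/quotW: v => y; rewrite pi_meet pi_join meetKU.
Qed.

Fact qmeetUl : left_distributive qmeet qjoin.
Proof.
elim/quotW=> x; elim/quotW=> y; elim/quotW=> z.
by rewrite pi_join !pi_meet pi_join meetUl.
Qed.

Fact qmeetxx : idempotent_op qmeet.
Proof. by elim/quotW=> x; rewrite pi_meet meetxx. Qed.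

Fact quotient_display : Order.disp_t. Proof. exact: Order.Disp tt tt. Qed.

HB.instance Definition _ :=
  Order.isMeetJoinDistrLattice.Build quotient_display quotient_algebra
    qle_def qlt_def qmeetC qjoinC qmeetA qjoinA qjoinKI qmeetKU qmeetUl qmeetxx.

Fact qle0 u : qclass \bot <= u.
Proof. by elim/quotW: u => x; apply/eqP; rewrite pi_meet meet0x. Qed.

Fact qle1 u : u <= qclass \top.
Proof. by elim/quotW: u => x; apply/eqP; rewrite pi_meet meetx1. Qed.

HB.instance Definition _ :=
  Order.hasBottom.Build quotient_display quotient_algebra qle0.
HB.instance Definition _ :=
  Order.hasTop.Build quotient_display quotient_algebra qle1.

Fact qjoinxC u : u `|` qcompl u = \top.
Proof. by elim/quotW: u => x; rewrite pi_compl [LHS]pi_join joinxC. Qed.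

Fact qmeetxC u : u `&` qcompl u = \bot.
Proof. by elim/quotW: u => x; rewrite pi_compl [LHS]pi_meet meetxC. Qed.

HB.instance Definition _ := Order.TBDistrLattice_hasComplement.Build
  quotient_display quotient_algebra qjoinxC qmeetxC.

Lemma qclass_surj u : exists x, qclass x = u.
Proof. by exists (qrepr u); exact: qreprK. Qed.

Lemma qclassI x y : qclass (x `&` y) = qclass x `&` qclass y.
Proof. by rewrite -pi_meet. Qed.

Lemma qclassU x y : qclass (x `|` y) = qclass x `|` qclass y.
Proof. by rewrite -pi_join. Qed.

Lemma qclassC x : qclass (~` x) = ~` qclass x.
Proof. by rewrite -pi_compl. Qed.

Lemma qclass_eq0 x : qclass x = \bot <-> I x.
Proof.
apply: (iff_trans (qclass_eq x \bot)); rewrite /ideal_equiv diffx0 diff0x joinx0.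
by split=> /asboolP.
Qed.

End quotient_algebra.

Section relative_algebra.
Variables (d : Order.disp_t) (B : ctbDistrLatticeType d) (b : B).

Definition relative_algebra : Type := {c : B | c <= b}.

HB.instance Definition _ := SubChoice.on relative_algebra.

Implicit Types x y z : relative_algebra.

Let relP x : val x <= b. Proof. exact: (svalP x). Qed.

Definition rel_meet x y : relative_algebra :=
  exist _ (val x `&` val y) (le_trans (leIl _ _) (relP x)).
Definition rel_join x y : relative_algebra :=
  exist _ (val x `|` val y)
    (etrans (leUx _ _ _) (introT andP (conj (relP x) (relP y)))).
Definition rel_compl x : relative_algebra :=
  exist _ (b `\` val x) (leBx _ _).
Definition rel_bot : relative_algebra := exist _ \bot (le0x b).
Definition rel_top : relative_algebra := exist _ b (lexx b).

Definition rel_le x y : bool := val x <= val y.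
Definition rel_lt x y : bool := (y != x) && rel_le x y.

Fact rel_le_def x y : rel_le x y = (rel_meet x y == x).
Proof. by rewrite -val_eqE /= -leEmeet. Qed.
Fact rel_lt_def x y : rel_lt x y = (y != x) && rel_le x y. Proof. by []. Qed.
Fact rel_meetC : commutative rel_meet.
Proof. by move=> x y; apply: val_inj; exact: meetC. Qed.
Fact rel_joinC : commutative rel_join.
Proof. by move=> x y; apply: val_inj; exact: joinC. Qed.
Fact rel_meetA : associative rel_meet.
Proof. by move=> x y z; apply: val_inj; exact: meetA. Qed.
Fact rel_joinA : associative rel_join.
Proof. by move=> x y z; apply: val_inj; exact: joinA. Qed.
Fact rel_joinKI y x : rel_meet x (rel_join x y) = x.
Proof. by apply: val_inj; exact: joinKI. Qed.
Fact rel_meetKU y x : rel_join x (rel_meet x y) = x.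
Proof. by apply: val_inj; exact: meetKU. Qed.
Fact rel_meetUl : left_distributive rel_meet rel_join.
Proof. by move=> x y z; apply: val_inj; exact: meetUl. Qed.
Fact rel_meetxx : idempotent_op rel_meet.
Proof. by move=> x; apply: val_inj; exact: meetxx. Qed.

Fact relative_display : Order.disp_t. Proof. exact: Order.Disp tt tt. Qed.

HB.instance Definition _ :=
  Order.isMeetJoinDistrLattice.Build relative_display relative_algebra
    rel_le_def rel_lt_def rel_meetC rel_joinC rel_meetA rel_joinA
    rel_joinKI rel_meetKU rel_meetUl rel_meetxx.

Fact rel_le0 x : rel_bot <= x. Proof. exact: (le0x (val x)). Qed.
Fact rel_le1 x : x <= rel_top. Proof. exact: (relP x). Qed.

HB.instance Definition _ :=
  Order.hasBottom.Build relative_display relative_algebra rel_le0.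
HB.instance Definition _ :=
  Order.hasTop.Build relative_display relative_algebra rel_le1.

Fact rel_joinxC x : x `|` rel_compl x = \top.
Proof. by apply: val_inj; exact: (leBKU (relP x)). Qed.
Fact rel_meetxC x : x `&` rel_compl x = \bot.
Proof. by apply: val_inj; exact: diffKI. Qed.

HB.instance Definition _ := Order.TBDistrLattice_hasComplement.Build
  relative_display relative_algebra rel_joinxC rel_meetxC.

End relative_algebra.

(* Spelled out because [{tblmorphism _ -> _}] does not include preservation of
   meets and joins. *)
Definition boolalg_iso (d d' : Order.disp_t) (A : ctbDistrLatticeType d)
    (B : ctbDistrLatticeType d') (h : A -> B) : Prop :=
  [/\ bijective h,
      {morph h : x y / x `&` y}, {morph h : x y / x `|` y},
      {morph h : x / ~` x} & (h \bot = \bot) /\ (h \top = \top)].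

(* A Boolean algebra whose domain is a subset of 2^omega is presented as a
   Boolean algebra B with an injection [code] into 2^omega; the domain is
   [range code]. [ctbDistrLatticeType] admits the one-element algebra, which is
   excluded here. *)

Section borel_algebra.
Variables (d : Order.disp_t) (B : ctbDistrLatticeType d).
Variable code : B -> cantor_space.

Definition code2 (p : B * B) : cantor_space * cantor_space :=
  (code p.1, code p.2).

Definition borel_boolalg : Prop :=
  [/\ (\bot : B) != \top,
      injective code,
      borel (range code),
      borel (code2 @` [set p | p.1 <= p.2]) &
      borel (code2 @` [set p | p.1 `&` p.2 = \bot])].

Definition borel_homogeneous : Prop :=
  [/\ borel_boolalg,
      coded_borel_fun code2 code (fun p : B * B => p.1 `&` p.2) &
      forall b : B, b != \bot ->
        exists2 h : relative_algebra b -> B,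
          boolalg_iso h &
          coded_borel_fun (fun c : relative_algebra b => code (val c)) code h].

End borel_algebra.

Definition reaps (d : Order.disp_t) (A : ctbDistrLatticeType d) (b r : A) : Prop :=
  r <= b \/ r `&` b = \bot.

Section reduced_power.
Variables (d : Order.disp_t) (B : ctbDistrLatticeType d).

Definition Fin_set : set (nat -> B) := [set f | finite_set [set n | \bot < f n]].

Fact Fin0 : Fin_set \bot.
Proof.
by rewrite /Fin_set /= (_ : [set n | _] = set0) // -subset0 => n /=; rewrite ltxx.
Qed.

Fact Fin_down f g : f <= g -> Fin_set g -> Fin_set f.
Proof. by move=> /lefP fg; apply: sub_finite_set => n /= /lt_le_trans; exact. Qed.

Fact FinU f g : Fin_set f -> Fin_set g -> Fin_set (f `|` g).
Proof.
move=> finf fing; rewrite /Fin_set /=.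
have : finite_set ([set n | \bot < f n] `|` [set n | \bot < g n])%classic.
  by rewrite finite_setU.
apply: sub_finite_set => n /=; rewrite joinfE !lt0x join_eq0 negb_and.
by move/orP.
Qed.

Definition Fin : ideal (nat -> B) := Ideal Fin0 Fin_down FinU.

Definition reduced_power : ctbDistrLatticeType quotient_display :=
  quotient_algebra Fin.

Variable code : B -> cantor_space.

Definition code_seq (f : nat -> B) : prod_topology (fun _ : nat => cantor_space) :=
  fun n => code (f n).

Definition reaping_relsys : relsys :=
  @RelSys (prod_topology (fun _ : nat => cantor_space))
    (range code_seq)
    [set (code_seq p.1, code_seq p.2) | p in
       [set p : (nat -> B) * (nat -> B) |
          ~ Fin p.2 /\ reaps (qclass Fin p.1) (qclass Fin p.2)]]
    (code_seq @` [set g | ~ Fin g]).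

End reduced_power.

(* [K] represents the minimum cardinality of a cofinal subset of (U, le). *)
Definition cofinality_is (T V : Type) (le : T -> T -> Prop) (U : set T)
    (K : set V) : Prop :=
  let cofinal (D : set T) :=
    D `<=` U /\ forall x, U x -> exists2 y, D y & le x y in
  (exists2 D, cofinal D & D #= K) /\ (forall D, cofinal D -> K #<= D).

Section ultrafilter_number.
Variables (d : Order.disp_t) (A : ctbDistrLatticeType d).

Definition boolalg_ultrafilter (U : set A) : Prop :=
  [/\ U \top, ~ U \bot,
      forall x y, U x -> x <= y -> U y,
      forall x y, U x -> U y -> U (x `&` y) &
      forall x, U x \/ U (~` x)].

Definition principal (U : set A) : Prop := exists a, U = [set x | a <= x].

Definition nonprincipal_ultrafilter (U : set A) : Prop :=
  boolalg_ultrafilter U /\ ~ principal U.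

Definition ultrafilter_number_is (V : Type) (K : set V) : Prop :=
  (exists2 U, nonprincipal_ultrafilter U &
     cofinality_is (fun x y : A => y <= x) U K) /\
  (forall U (D : set A), nonprincipal_ultrafilter U ->
     cofinality_is (fun x y : A => y <= x) U D -> K #<= D).

End ultrafilter_number.

(* Main.v *)
(* The lower bound: a countable base of an ultrafilter on the reduced power has a
   nonzero pseudo-intersection (diagonalize), which can be split in two, so every
   base is uncountable.

   The upper bound: build a decreasing tower (u_a) of length omega1.  Stage a
   enumerates a as en_a 0, en_a 1, ..., picks increasing coordinates nu_k at which
   p_k := u_(en_a 0) /\ ... /\ u_(en_a k) is nonzero, and lets u_a(nu_k) be the
   preimage of g_a(k) under an isomorphism h of the algebra below p_k(nu_k) onto B,
   where g is the diamond guess.  Given c in the power of B, the element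
   h(c(nu_k) /\ p_k(nu_k)) only depends on the finite sequence en_a 0, ..., en_a k,
   so f : omega1 -> 2 can simply list these elements for all finite sequences of
   countable ordinals, and the function F of the diamond principle only has to read
   off bits of f below a.  It is therefore continuous up to a correction of
   ill-formed inputs, and the dependence of h on p_k(nu_k) need not be Borel.
   Whenever g_a reaps F(f restricted to a), u_a reaps c. *)

Require Import Defs.
From mathcomp Require Import all_boot all_order all_algebra.
From mathcomp Require Import boolp classical_sets functions cardinality.
From mathcomp Require Import reals topology cantor measurable_structure.

Set Implicit Arguments.
Unset Strict Implicit.
Unset Printing Implicit Defensive.

Import Order.Theory GRing.Theory Num.Theory.

Local Open Scope classical_set_scope.
Local Open Scope card_scope.
Local Open Scope order_scope.

(** * Recursion, bounds and cardinality on the first uncountable ordinal *)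

Lemma countableU (T : Type) (A B : set T) :
  countable A -> countable B -> countable (A `|` B).
Proof.
move=> cA cB; rewrite -bigcup2E; apply: bigcup_countable => // -[|[|n]] _ //=.
Qed.

Lemma omega1_wf : well_founded (fun x y : omega1 => x < y).
Proof.
move=> a; apply: contrapT => na.
have [|z nz zmin] := @omega1_min [set x | ~ Acc (fun x y : omega1 => x < y) x].
  by exists a.
apply: nz; constructor => y yz; apply: contrapT => ny.
by have := zmin y ny; rewrite leNgt yz.
Qed.

(** The history is passed to [G] as a total function, padded with [t0] from [x] on, so that no
    dependent types reach the users. *)
Lemma omega1_recursion (T : Type) (t0 : T) (G : omega1 -> (omega1 -> T) -> T) :
  exists u, forall x, u x = G x (fun y => if y < x then u y else t0).
Proof.
pose H x (r : forall y, y < x -> T) :=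
  G x (fun y => if pselect (y < x) is left yx then r y yx else t0).
exists (Fix omega1_wf (fun=> T) H) => x.
rewrite Fix_eq; last first.
  by move=> z r r' rr'; congr (G z _); apply/funext => y; case: pselect.
by congr (G x _); apply/funext => y; case: pselect => [->|/negP/negbTE ->].
Qed.

(** Otherwise the closed initial segments given by the points of [C] would cover [omega1] by
    countably many countable sets. *)
Lemma omega1_countable_bound (C : set omega1) : countable C ->
  exists b, forall c, C c -> c < b.
Proof.
move=> cC; apply: contrapT => nb; apply: omega1_uncountable.
have -> : [set: omega1] = \bigcup_(c in C) ([set c] `|` [set y | y < c]).
  apply/seteqP; split=> // b _; apply: contrapT => nCb; apply: nb; exists b => c Cc.
  rewrite ltNge le_eqVlt; apply/negP => /orP[/eqP bc|bc]; apply: nCb; exists c => //.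
    by left.
  by right.
apply: bigcup_countable => // c _; apply: countableU; first exact: countable1.
exact: omega1_countable_segment.
Qed.

Lemma omega1_bounds : exists bnd : set omega1 -> omega1,
  forall C, countable C -> forall c, C c -> c < bnd C.
Proof.
have /choice[bnd bndP] (C : set omega1) :
    exists b, countable C -> forall c, C c -> c < b.
  have [cC|ncC] := pselect (countable C).
    by have [b Cb] := omega1_countable_bound cC; exists b.
  by have [b _] := omega1_countable_bound (countable0 omega1); exists b.
by exists bnd.
Qed.

Lemma omega1_least : exists x0 : omega1, forall x, x0 <= x.
Proof.
have [b _] := omega1_countable_bound (countable0 omega1).
by have [|x0 _ x0P] := @omega1_min setT; [exists b|exists x0 => x; exact: x0P].
Qed.

(** Recursion picks at each stage a point of [D] not picked before. It never stalls, since only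
    countably many points are taken before a given stage. *)
Lemma omega1_card_le (T : Type) (D : set T) :
  ~ countable D -> [set: omega1] #<= D.
Proof.
move=> ncD.
have /choice[ch chP] (C : set T) : exists x, countable C -> D x /\ ~ C x.
  have [cC|ncC] := pselect (countable C); last first.
    have [x _] : exists x, D x by apply: contrapT => /forallNP D0; apply: ncD;
      rewrite (_ : D = set0) //; apply/seteqP; split=> // x /D0.
    by exists x.
  apply: contrapT => /forallNP nx; apply: ncD.
  apply: sub_countable cC; apply: subset_card_le => x Dx.
  by apply: contrapT => nCx; apply: (nx x).
have [u uE] := omega1_recursion (ch set0)
  (fun x v => ch [set v y | y in [set y | y < x]]).
have uP x : D (u x) /\ forall y, y < x -> u y <> u x.
  rewrite uE; set C := [set _ | _ in _]; have [|Dx nCx] := chP C.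
    by apply: card_le_trans (card_image_le _ _) (omega1_countable_segment x).
  by split=> // y yx uyx; apply: nCx; exists y => //=; rewrite yx.
have uinj : {in [set: omega1] &, injective u}.
  move=> x y _ _ uxy; case: (ltgtP x y) => // xy.
    by case: (uP y) => _ /(_ _ xy).
  by case: (uP x) => _ /(_ _ xy); rewrite uxy.
rewrite -(card_le_eql (inj_card_eq uinj)); apply: subset_card_le => _ [x _ <-].
by case: (uP x).
Qed.

(** * Clubs and the coding of finite sequences of countable ordinals *)

Lemma club_closure_points (a : omega1) (beta : omega1 -> omega1) :
  club [set x | a < x /\ forall y, y < x -> beta y < x].
Proof.
split=> [b|x [[b bx] _] xlim]; last first.
  split; first by have [c [ac _] /andP[_ cx]] := xlim b bx; exact: lt_trans ac cx.
  by move=> y /xlim[c [_ cP] /andP[/cP bc cx]]; exact: lt_trans bc cx.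
have [bnd bndP] := omega1_bounds.
(* [nx x] exceeds [x] and all values of [beta] below [x]; the supremum of its iterates is therefore
   a closure point. *)
pose nx x := bnd ([set x] `|` (beta @` [set y | y < x])).
have cnx x : countable ([set x] `|` (beta @` [set y | y < x])).
  apply: countableU; first exact: countable1.
  by apply: card_le_trans (card_image_le _ _) (omega1_countable_segment x).
have nxl x : x < nx x by apply: bndP (cnx x) _ _; left.
have nxb x y : y < x -> beta y < nx x.
  by move=> yx; apply: bndP (cnx x) _ _; right; exists y.
pose s n := iter n nx (Order.max a b).
have [|z zP zmin] := @omega1_min [set z | forall n, s n <= z].
  exists (bnd (range s)) => n; apply: ltW; apply: bndP; last by exists n.
  by apply: card_le_trans (card_image_le _ _) (countableP _).
have sz n : s n < z by apply: lt_le_trans (zP n.+1); exact: nxl.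
have /= := sz 0%N; rewrite gt_max => /andP[az bz].
exists z => //; split=> // y yz.
have [n yn] : exists n, y < s n.
  apply: contrapT => /forallNP ny; have := zmin y; rewrite leNgt yz => H.
  by case: notF; apply: H => n; rewrite leNgt; apply/negP; exact: ny.
by apply: lt_le_trans (zP n.+1); exact: nxb.
Qed.

(** Block [x] consists of the iterates of a strictly increasing step from a start [u x], and each
    start is chosen above all earlier blocks, so blocks are disjoint. *)
Lemma omega1_blocks : exists e : omega1 -> nat -> omega1,
  forall x y m n, e x m = e y n -> x = y /\ m = n.
Proof.
have [bnd bndP] := omega1_bounds.
pose nx x := bnd [set x].
have nxl x : x < nx x by apply: bndP => //; exact: countable1.
have [x0 _] := omega1_least.
have [u uE] := omega1_recursion x0 (fun x v =>
  bnd (\bigcup_(y in [set y | y < x]) range (fun n => iter n nx (v y)))).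
have uP x y n : y < x -> iter n nx (u y) < u x.
  move=> yx; rewrite [u x]uE; apply: bndP; last first.
    by exists y => //=; exists n => //; rewrite yx.
  apply: bigcup_countable => [|z _]; first exact: omega1_countable_segment.
  by apply: card_le_trans (card_image_le _ _) (countableP _).
have lt_it x m n : (m < n)%N -> iter m nx x < iter n nx x.
  elim: n => // n IH; rewrite ltnS leq_eqVlt => /orP[/eqP ->|/IH lt]; first exact: nxl.
  exact: lt_trans lt (nxl _).
have it_ge x n : x <= iter n nx x.
  by case: n => // n; apply: ltW; exact: (@lt_it x 0%N).
exists (fun x n => iter n nx (u x)) => x y m n exy.
have xy : x = y.
  case: (ltgtP x y) => // [/(uP _ _ m)|/(uP _ _ n)].
    by rewrite exy ltNge it_ge.
  by rewrite -exy ltNge it_ge.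
split=> //; rewrite {}xy in exy.
by case: (ltngtP m n) => // /(lt_it (u y)); rewrite exy ltxx.
Qed.

(** The code of [(s, j)] lies in the block of the maximum of [s] and [x0]. That block determines a
    countable segment containing [s], and an injection of the segment into [nat] turns [s] into the
    position inside the block. As [beta] bounds each block, ordinals closed under [beta] contain the
    codes of their own finite sequences. *)
Lemma omega1_seq_code (x0 : omega1) :
  exists e : seq omega1 * nat -> omega1, exists beta : omega1 -> omega1,
    injective e /\
    forall d s j, x0 < d -> all (< d) s -> (forall y, y < d -> beta y < d) ->
      e (s, j) < d.
Proof.
have [e eP] := omega1_blocks; have [bnd bndP] := omega1_bounds.
have /choice[iota iotaP] (x : omega1) : exists f : omega1 -> nat,
    {in [set y | y < x] &, injective f}.
  by have /countable_injP[f finj] := omega1_countable_segment x; exists f.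
pose r s := foldr Order.max x0 s : omega1.
pose up s := bnd [set r s].
have r_up s : all (< up s) s.
  apply/allP => x xs; have le_r : x <= r s.
    elim: s xs {up} => //= y s IH; rewrite inE le_max => /orP[/eqP->|/IH ->].
      by rewrite lexx.
    by rewrite orbT.
  by apply: le_lt_trans le_r _; apply: bndP => //; exact: countable1.
exists (fun p => e (r p.1) (pickle (map (iota (up p.1)) p.1, p.2))).
exists (fun x => bnd (range (e x))); split.
  move=> [s j] [s' j'] /= /eP[rss' /(pcan_inj pickleK)[ss' ->]]; congr (_, _).
  have uss' : up s' = up s by rewrite /up rss'.
  rewrite uss' in ss'.
  move: (r_up s) (r_up s'); rewrite uss'; move: (up s) ss' => U.
  elim: s s' {rss' uss'} => [|x t IH] [|x' t'] //= [xx' tt'].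
  move=> /andP[xu tu] /andP[x'u t'u]; rewrite (IH t') //.
  by rewrite (iotaP _ _ _ _ _ xx') // inE.
move=> d s j x0d sd dP; apply: lt_trans (dP (r s) _); last first.
  by elim: s sd => //= x s IH /andP[xd /IH rd]; rewrite gt_max xd.
apply: bndP; first by apply: card_le_trans (card_image_le _ _) (countableP _).
by exists (pickle (map (iota (up s)) s, j)).
Qed.

(** * Continuity into products and closure properties of Borel sets *)

Lemma prod_topology_cvg (I : Type) (K : I -> topologicalType)
    (F : set_system (prod_topology K)) (t : prod_topology K) :
  Filter F -> (forall i, f i @[f --> F] --> t i) -> F --> t.
Proof.
move=> FF Ft; apply/cvg_sup => i U.
have /= -> := @nbhsE (initial_topology (fun f : prod_topology K => f i)) t.
case=> B [[C oC <-] Ct] /filterS; apply; apply: Ft.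
exact: open_nbhs_nbhs.
Qed.

Lemma prod_topology_continuous (X : topologicalType) (I : Type)
    (K : I -> topologicalType) (f : X -> prod_topology K) :
  (forall i, continuous (fun x => f x i)) -> continuous f.
Proof. by move=> cf x; apply: prod_topology_cvg => i; exact: cf. Qed.

Lemma pair_continuous (X Y Z : topologicalType) (f : X -> Y) (g : X -> Z) :
  continuous f -> continuous g -> continuous (fun x => (f x, g x)).
Proof. by move=> cf cg x; exact: (cvg_pair (cf x) (cg x)). Qed.

Section borel_sets.
Variable X : topologicalType.
Implicit Types A B : set X.

Lemma borelC A : borel A -> borel (~` A)%classic.
Proof. by rewrite -setTD; exact: sigma_algebraCD. Qed.

Lemma borel_bigcup (F : nat -> set X) :
  (forall n, borel (F n)) -> borel (\bigcup_n F n).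
Proof. exact: sigma_algebra_bigcup. Qed.

Lemma borelT : borel [set: X].
Proof. by rewrite -setC0; apply: borelC; exact: sigma_algebra0. Qed.

Lemma borel_bigcap (F : nat -> set X) :
  (forall n, borel (F n)) -> borel (\bigcap_n F n).
Proof.
move=> bF; rewrite -[X in borel X]setCK setC_bigcap; apply: borelC.
by apply: borel_bigcup => n; exact: borelC.
Qed.

Lemma borelU A B : borel A -> borel B -> borel (A `|` B)%classic.
Proof.
move=> bA bB; rewrite -bigcup2E; apply: borel_bigcup => -[|[|n]] //=.
exact: sigma_algebra0.
Qed.

Lemma borelI A B : borel A -> borel B -> borel (A `&` B)%classic.
Proof.
move=> bA bB; rewrite -[X in borel X]setCK setCI; apply: borelC.
by apply: borelU; exact: borelC.
Qed.

Lemma borel_eventually (F : nat -> set X) : (forall n, borel (F n)) ->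
  borel [set x | exists N, forall n, (N <= n)%N -> F n x].
Proof.
move=> bF.
have -> : [set x | exists N, forall n, (N <= n)%N -> F n x] =
    \bigcup_N \bigcap_n (if (N <= n)%N then F n else setT).
  apply/seteqP; split=> [x [N NF]|x [N _ NF]]; exists N => //.
    by move=> n _; case: ifP => // /NF.
  by move=> n Nn; have := NF n I; rewrite Nn.
apply: borel_bigcup => N; apply: borel_bigcap => n; case: ifP => // _.
exact: borelT.
Qed.

End borel_sets.

Lemma continuous_borel_fun (X Y : topologicalType) (f : X -> Y) :
  continuous f -> borel_fun f.
Proof.
move=> cf; rewrite /borel_fun.
(* The sets with Borel preimage form a sigma-algebra containing the open sets. *)
have : @borel Y `<=` [set C | borel (f @^-1` C)].
  apply: smallest_sub => [|C oC]; last first.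
    by apply: sub_sigma_algebra; apply: open_comp => // x _; exact: cf.
  split=> [|C bC|C bC] /=.
  - by rewrite preimage_set0; exact: sigma_algebra0.
  - by rewrite setTD preimage_setC; exact: borelC.
  - by rewrite preimage_bigcup; exact: borel_bigcup.
by move=> sub C; exact: sub.
Qed.

(** * The space of sequences in the Cantor space is Polish *)

Definition cantor_seq := prod_topology (fun _ : nat => cantor_space).

Section cantor_seq_polish.
Implicit Types x y z : cantor_seq.

Definition agree n x y :=
  forall i j, (i < n)%N -> (j < n)%N -> x i j = y i j.

Lemma agreeW m n x y : (m <= n)%N -> agree n x y -> agree m x y.
Proof. by move=> mn xy i j im jm; apply: xy; exact: leq_trans mn. Qed.

Lemma agree_sym n x y : agree n x y -> agree n y x.
Proof. by move=> xy i j im jm; rewrite xy. Qed.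

Lemma agree_trans n y x z : agree n x y -> agree n y z -> agree n x z.
Proof. by move=> xy yz i j im jm; rewrite xy ?yz. Qed.

Lemma nbhs_agree x (U : set cantor_seq) :
  nbhs x U <-> exists n, [set y | agree n x y] `<=` U.
Proof.
split=> [|[n]].
  have FF : Filter (filter_from [set: nat] (fun n => [set y | agree n x y])).
    apply: filter_from_filter => [|m n _ _]; first by exists 0%N.
    exists (maxn m n) => // y xy.
    by split; apply: agreeW xy; rewrite ?leq_maxl ?leq_maxr.
  have : filter_from [set: nat] (fun n => [set y | agree n x y]) --> x.
    apply: prod_topology_cvg => i; apply: prod_topology_cvg => j V.
    move=> /principal_filterP Vxij; exists (maxn i j).+1 => // y xy /=.
    by rewrite -xy ?ltnS ?leq_maxl ?leq_maxr.
  by move=> cvx /cvx[n _ nU]; exists n.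
move=> /filterS; apply.
(* Agreement on a finite square is a finite conjunction of conditions on single bits, each of them
   open because [bool] is discrete. *)
have : \forall y \near x, forall p : 'I_n * 'I_n,
    x p.1 p.2 = (y : cantor_seq) p.1 p.2.
  apply: (@filter_forall _ _ (fun (p : 'I_n * 'I_n) (y : cantor_seq) =>
    x p.1 p.2 = y p.1 p.2) _ (nbhs_filter x)) => -[i j] /=.
  have cij : continuous (fun y : cantor_seq => y i j : bool).
    move=> y; apply: (@continuous_comp _ _ _ (fun y : cantor_seq => y i)
      (fun w : cantor_space => w j)).
      exact: (@proj_continuous _ (fun _ : nat => cantor_space)).
    exact: (@proj_continuous _ (fun _ : nat => bool)).
  by have := cij x _ (discrete_set1 (x i j)); apply: filterS => y /= ->.
by apply: filterS => y xy i j im jm; exact: (xy (Ordinal im, Ordinal jm)).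
Qed.

(* The value is 0 when no [n] satisfies [P]. *)
Definition first_nat (P : pred nat) : nat :=
  if pselect (exists n, P n) is left exP then ex_minn exP else 0%N.

Section metric.
Local Open Scope ring_scope.
Variable R : realType.

(** The inverse side of the least square on which [x] and [y] differ. For equal points the default 0
    of [first_nat] and the convention [0^-1 = 0] give distance 0. *)
Definition cantor_seq_dist x y : R :=
  (first_nat (fun n => `[< ~ agree n x y >]))%:R^-1.

Lemma cantor_seq_dist_lt n x y : (0 < n)%N ->
  cantor_seq_dist x y < n%:R^-1 <-> agree n x y.
Proof.
move=> n0; rewrite /cantor_seq_dist /first_nat; case: pselect => [H|/forallNP H].
  case: ex_minnP => N /asboolP NN Nmin.
  have N0 : (0 < N)%N by case: (N) NN => // -[].
  rewrite ltf_pV2 ?posrE ?ltr0n // ltr_nat; split=> [nN|nxy].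
    by apply: contrapT => /asboolP/Nmin; rewrite leqNgt nN.
  by rewrite ltnNge; apply/negP => Nn; apply: NN; exact: agreeW nxy.
rewrite invr0 invr_gt0 ltr0n n0; split=> // _.
by apply: contrapT => /asboolP; exact: H.
Qed.

Lemma cantor_seq_dist_ge0 x y : 0 <= cantor_seq_dist x y.
Proof. by rewrite invr_ge0. Qed.

Lemma cantor_seq_dist_metric : is_metric cantor_seq_dist.
Proof.
split=> [x y|x y|x y z].
- split=> [d0|->].
    apply/funext => i; apply/funext => j.
    have : agree (maxn i j).+1 x y.
      by apply/cantor_seq_dist_lt => //; rewrite d0 invr_gt0.
    by apply; rewrite ltnS ?leq_maxl ?leq_maxr.
  rewrite /cantor_seq_dist /first_nat; case: pselect => [exn|_].
    by case: (exn) => n /asboolP[].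
  by rewrite invr0.
- congr (_%:R^-1); congr first_nat; apply/funext => n.
  by apply: asbool_equiv_eq; split=> H /agree_sym.
- rewrite leNgt; apply/negP.
  have [->|/eqP dxz0] := cantor_seq_dist x z =P 0.
    by rewrite ltNge addr_ge0 ?cantor_seq_dist_ge0.
  (* Here [1/N] is the distance from [x] to [z]. If the sum were smaller, both pairs would agree on
     the square of side [N], hence so would [x] and [z]. *)
  set N := first_nat (fun n => `[< ~ agree n x z >]).
  have N0 : (0 < N)%N.
    by rewrite lt0n; apply: contraNneq dxz0 => N0; rewrite /cantor_seq_dist -/N N0 invr0.
  rewrite [X in _ < X](_ : _ = N%:R^-1) // => lt.
  have : cantor_seq_dist x z < N%:R^-1.
    apply/(cantor_seq_dist_lt _ _ N0); apply: (@agree_trans N y).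
      apply/(cantor_seq_dist_lt _ _ N0); apply: le_lt_trans lt.
      by rewrite lerDl cantor_seq_dist_ge0.
    apply/(cantor_seq_dist_lt _ _ N0); apply: le_lt_trans lt.
    by rewrite lerDr cantor_seq_dist_ge0.
  by rewrite ltxx.
Qed.

Lemma cantor_seq_dist_topology : metric_induces_topology cantor_seq_dist.
Proof.
move=> x U; split=> [/nbhs_agree[n nU]|[e e0 eU]].
  exists (n.+1%:R^-1) => [|y /= /cantor_seq_dist_lt xy]; first by rewrite invr_gt0.
  by apply: nU; apply: agreeW (xy _).
apply/nbhs_agree; have [n] := ltr_add_invr e0; rewrite add0r => ne.
exists n.+1 => y xy; apply: eU => /=; apply: lt_trans ne.
exact/cantor_seq_dist_lt.
Qed.

Lemma cantor_seq_dist_complete : metric_complete cantor_seq_dist.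
Proof.
move=> u uC.
have /choice[N NP] n : exists N, forall m, (N <= m)%N -> agree n.+1 (u N) (u m).
  have [|N NP] := uC (n.+1%:R^-1); first by rewrite invr_gt0.
  by exists N => m Nm; apply/cantor_seq_dist_lt => //; exact: NP.
(* From index [N (maxn i j)] on, the bit at [(i, j)] is constant; the limit takes that value. *)
exists (fun i j => u (N (maxn i j)) i j : bool) => U /nbhs_agree[n nU].
exists (N n) => // m Nm; apply: nU => i j im jm.
have ik : (i < (maxn i j).+1)%N by rewrite ltnS leq_maxl.
have jk : (j < (maxn i j).+1)%N by rewrite ltnS leq_maxr.
pose M := maxn (N n) (N (maxn i j)).
have -> := NP _ M (leq_maxr _ _) i j ik jk.
have <- := NP _ M (leq_maxl _ _) i j (ltnW im) (ltnW jm).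
exact: (NP n m Nm i j (ltnW im) (ltnW jm)).
Qed.

Lemma cantor_seq_polish : polish R cantor_seq.
Proof.
split; last first.
  exists cantor_seq_dist; split; first exact: cantor_seq_dist_metric.
    exact: cantor_seq_dist_topology.
  exact: cantor_seq_dist_complete.
(* The countable dense set consists of the points with finitely many bits equal to 1. *)
pose dec (s : seq (nat * nat)) : cantor_seq := fun i j => (i, j) \in s.
exists (range dec).
  by apply: card_le_trans (card_image_le _ _) (countableP _).
move=> O [x Ox] oO.
have /nbhs_agree[n nO] : nbhs x O by exact: open_nbhs_nbhs.
pose s := [seq p <- [seq (i, j) | i <- iota 0 n, j <- iota 0 n] | x p.1 p.2].
exists (dec s); split; last by exists s.
apply: nO => i j im jm; rewrite /dec mem_filter /=.
rewrite (_ : (i, j) \in _ = true) ?andbT //.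
by apply/allpairsP; exists (i, j); rewrite !mem_iota.
Qed.

End metric.
End cantor_seq_polish.

(** * Order, disjointness and diagonalization modulo [Fin] *)

Section reduced_power_order.
Variables (d : Order.disp_t) (B : ctbDistrLatticeType d).
Implicit Types f g : nat -> B.

Lemma FinP f : Fin B f <-> exists N, forall n, (N <= n)%N -> f n = \bot.
Proof.
split=> [finf|[N fN]]; last first.
  apply: (sub_finite_set _ (finite_II N)) => n /=.
  by rewrite ltnNge lt0x; apply: contra => /fN ->.
have [N fN] : exists N, forall n, \bot < f n -> (n < N)%N.
  have /finite_seqP[s sE] : finite_set [set n | \bot < f n] by [].
  exists (\max_(n <- s) n).+1 => n fn; rewrite ltnS; apply: leq_bigmax_seq => //.
  by have : [set` s] n by rewrite -sE.
exists N => n Nn; apply/eqP; rewrite -[_ == _]negbK -lt0x; apply/negP => /fN.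
by rewrite ltnNge Nn.
Qed.

Lemma NFinP f : ~ Fin B f <-> forall N, exists2 n, (N <= n)%N & f n != \bot.
Proof.
split=> [nf N|nf /FinP[N fN]]; last first.
  by have [n /fN -> /eqP] := nf N.
apply: contrapT => H; apply: nf; apply/FinP; exists N => n Nn.
by apply: contrapT => /eqP fn; apply: H; exists n.
Qed.

Lemma qclass_disj f g : qclass (Fin B) f `&` qclass (Fin B) g = \bot <->
  exists N, forall n, (N <= n)%N -> f n `&` g n = \bot.
Proof. by rewrite -qclassI; apply: iff_trans (qclass_eq0 _ _) (FinP _). Qed.

Lemma qclass_le f g : qclass (Fin B) f <= qclass (Fin B) g <->
  exists N, forall n, (N <= n)%N -> f n <= g n.
Proof.
rewrite -[qclass _ g]complK -disj_leC -qclassC.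
apply: iff_trans (iff_sym (rwP eqP)) _; apply: iff_trans (qclass_disj _ _) _.
have E n : (f n `&` (~` g) n == \bot) = (f n <= g n).
  by rewrite -[X in _ = (_ <= X)]complK -disj_leC.
split=> -[N fN]; exists N => n Nn; first by rewrite -E; apply/eqP; exact: fN.
by apply/eqP; rewrite E; exact: fN.
Qed.

(** Places [y k] at coordinate [nu k] and 0 off the range of [nu]. *)
Definition spread (nu : nat -> nat) (y : nat -> B) : nat -> B := fun n =>
  if pselect (exists k, nu k = n) is left H then y (sval (cid H)) else \bot.

Lemma spreadE nu y k : injective nu -> spread nu y (nu k) = y k.
Proof.
rewrite /spread => nuI; case: pselect => [H|[]]; last by exists k.
by congr y; apply: nuI; exact: (svalP (cid H)).
Qed.

Lemma spreadP nu y n :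
  spread nu y n = \bot \/ exists2 k, nu k = n & spread nu y n = y k.
Proof.
rewrite /spread; case: pselect => [H|]; [right|by left].
by exists (sval (cid H)) => //; exact: (svalP (cid H)).
Qed.

Fixpoint fmeet (v : nat -> nat -> B) k : nat -> B :=
  if k is k'.+1 then fmeet v k' `&` v k else v 0%N.

Lemma fmeet_le v i k n : (i <= k)%N -> fmeet v k n <= v i n.
Proof.
elim: k => [|k IH]; first by rewrite leqn0 => /eqP ->.
rewrite leq_eqVlt => /orP[/eqP ->|]; first exact: leIr.
by rewrite ltnS => /IH; exact: le_trans (leIl _ _).
Qed.

(* The junk value 0 is taken when [fmeet v k] vanishes from [lo] on. *)
Fixpoint diag (v : nat -> nat -> B) k : nat :=
  let lo := if k is k'.+1 then (diag v k').+1 else 0%N in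
  xget 0%N [set n | (lo <= n)%N /\ fmeet v k n != \bot].

Lemma eq_fmeet v w k : (forall i, (i <= k)%N -> v i = w i) ->
  fmeet v k = fmeet w k.
Proof.
elim: k => [|k IH] vw /=; first exact: vw.
by rewrite IH ?vw // => i ik; apply: vw; exact: leqW.
Qed.

(** This locality lets the bits needed at index [k] be attached to a finite sequence of ordinals
    instead of a whole enumeration. *)
Lemma eq_diag v w k : (forall i, (i <= k)%N -> v i = w i) ->
  diag v k = diag w k.
Proof.
move=> vw; elim: k vw => [|k IH] vw.
  by rewrite /diag (eq_fmeet vw).
rewrite [LHS]/= [RHS]/= -/(fmeet v k.+1) -/(fmeet w k.+1) (eq_fmeet vw) IH //.
by move=> i ik; apply: vw; exact: leqW.
Qed.

Section pseudo_intersection.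
Variables (v : nat -> nat -> B) (v_inf : forall k, ~ Fin B (fmeet v k)).

(** Each finite meet is nonzero at arbitrarily large coordinates, so every search in [diag]
    succeeds. *)
Lemma diag_spec k : fmeet v k (diag v k) != \bot /\ (diag v k < diag v k.+1)%N.
Proof.
pose next m k0 := xget 0%N [set n | (m <= n)%N /\ fmeet v k0 n != \bot].
have nextP m k0 : (m <= next m k0)%N /\ fmeet v k0 (next m k0) != \bot.
  have /NFinP/(_ m)[n mn fn] := v_inf (k := k0).
  exact: (@xgetI _ 0%N [set n | (m <= n)%N /\ fmeet v k0 n != \bot] n).
split; last by case: (nextP (diag v k).+1 k.+1).
by case: k => [|k]; [case: (nextP 0%N 0%N)|case: (nextP (diag v k).+1 k.+1)].
Qed.

Lemma diag_le : {mono diag v : m n / (m <= n)%N}.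
Proof.
by apply: leq_mono; apply: homo_ltn => [? ? ?|k]; [exact: ltn_trans|case: (diag_spec k)].
Qed.

Lemma diag_inj : injective (diag v).
Proof. exact: incn_inj diag_le. Qed.

Lemma diag_ge k : (k <= diag v k)%N.
Proof. by elim: k => // k IH; apply: leq_ltn_trans IH _; case: (diag_spec k). Qed.

End pseudo_intersection.

(** The witness keeps the [k]-th finite meet at the single coordinate [diag v k]; from [diag v i] on
    it is below [v i]. *)
Lemma pseudo_intersection (v : nat -> nat -> B) :
  (forall k, ~ Fin B (fmeet v k)) ->
  exists2 p, ~ Fin B p & forall i, qclass (Fin B) p <= qclass (Fin B) (v i).
Proof.
move=> v_inf; have dI := diag_inj v_inf.
exists (spread (diag v) (fun k => fmeet v k (diag v k))).
  apply/NFinP => N; exists (diag v N); first exact: diag_ge.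
  by rewrite spreadE //; case: (diag_spec v_inf N).
move=> i; apply/qclass_le; exists (diag v i) => n.
case: (spreadP (diag v) (fun k => fmeet v k (diag v k)) n) => [->|[k <- ->]].
  by rewrite le0x.
by rewrite diag_le // => ik; exact: fmeet_le.
Qed.

(** Choose infinitely many coordinates in the support of [g] and let [f] copy [g] at those of odd
    index only: the even ones refute [g <= f] and the odd ones refute disjointness. *)
Lemma split_not_reaped g : ~ Fin B g ->
  exists f, ~ reaps (qclass (Fin B) f) (qclass (Fin B) g).
Proof.
move=> ginf; pose v : nat -> nat -> B := fun=> g.
have vE k : fmeet v k = g by elim: k => //= k ->; exact: meetxx.
have v_inf k : ~ Fin B (fmeet v k) by rewrite vE.
have gd k : g (diag v k) != \bot by have [] := diag_spec v_inf k; rewrite vE.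
exists (spread (diag v) (fun k => if odd k then g (diag v k) else \bot)).
have dI := diag_inj v_inf.
case=> [/qclass_le|/qclass_disj] [N NP].
  suff /NP : (N <= diag v N.*2)%N.
    by rewrite spreadE // odd_double lex0 (negbTE (gd _)).
  by apply: leq_trans (diag_ge v_inf _); rewrite -addnn leq_addr.
suff /NP/eqP : (N <= diag v N.*2.+1)%N.
  by rewrite spreadE // (_ : odd _) ?oddS ?odd_double // meetxx (negbTE (gd _)).
by apply: leq_trans (diag_ge v_inf _); rewrite -addnn leqW ?leq_addr.
Qed.

End reduced_power_order.

(** * The reaping relation is a Borel relational system *)

Section reaping_borel.
Variables (d : Order.disp_t) (B : ctbDistrLatticeType d).
Variable code : B -> cantor_space.
Hypothesis codeB : borel_boolalg code.

Let code_inj : injective code. Proof. by case: codeB. Qed.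

Lemma code_seq_inj : injective (code_seq code).
Proof.
move=> f g fg; apply/funext => n; apply: code_inj.
exact: (congr1 (fun x : cantor_seq => x n) fg).
Qed.

Lemma range_code_seq :
  range (code_seq code) = \bigcap_n [set x : cantor_seq | range code (x n)].
Proof.
apply/seteqP; split=> [_ [f _ <-] n _|x xP]; first by exists (f n).
have /choice[f fP] n : exists b, code b = x n by have [b _ <-] := xP n I; exists b.
by exists f => //; apply/funext => n; exact: fP.
Qed.

Let proj_cts n : continuous (fun x : cantor_seq => x n : cantor_space).
Proof. exact: (@proj_continuous _ (fun _ : nat => cantor_space)). Qed.

Lemma borel_chal : borel (range (code_seq code)).
Proof.
rewrite range_code_seq; apply: borel_bigcap => n.
apply: (@continuous_borel_fun _ _ _ (@proj_cts n) (range code)).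
by case: codeB.
Qed.

Let disj_mem x y : (code2 code @` [set p | p.1 `&` p.2 = \bot]) (code x, code y) <->
  x `&` y = \bot.
Proof.
split=> [[[a b] /= ab [/code_inj <- /code_inj <-]]|xy] //.
by exists (x, y).
Qed.

Let le_mem x y : (code2 code @` [set p | p.1 <= p.2]) (code x, code y) <-> x <= y.
Proof.
split=> [[[a b] /= ab [/code_inj <- /code_inj <-]]|xy] //.
by exists (x, y).
Qed.

(** An element is 0 exactly when it is incompatible with itself, so membership in [Fin] is an
    eventual condition on the Borel incompatibility relation. *)
Lemma borel_resp : borel (code_seq code @` [set g | ~ Fin B g]).
Proof.
set P := code2 code @` [set p | p.1 `&` p.2 = \bot].
have -> : code_seq code @` [set g | ~ Fin B g] = (range (code_seq code) `&`
   ~` [set x : cantor_seq | exists N, forall n, (N <= n)%N -> P (x n, x n)])%classic.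
  apply/seteqP; split=> [_ [g ginf <-]|_ [[g _ <-] ginf]].
    split; first by exists g.
    move=> [N NP]; apply: ginf; apply/FinP; exists N => n /NP /disj_mem.
    by rewrite meetxx.
  exists g => // /FinP[N NP]; apply: ginf; exists N => n /NP gn.
  by apply/disj_mem; rewrite gn meetxx.
apply: borelI; first exact: borel_chal.
apply: borelC; apply: borel_eventually => n.
apply: (@continuous_borel_fun _ _ (fun x : cantor_seq => (x n, x n)) _ P).
  by apply: pair_continuous; exact: proj_cts.
by case: codeB.
Qed.

Lemma borel_rel : borel (rs_rel (reaping_relsys code)).
Proof.
set P := code2 code @` [set p | p.1 `&` p.2 = \bot].
set L := code2 code @` [set p | p.1 <= p.2].
pose ev (Q : set (cantor_space * cantor_space)) :=
  [set p : cantor_seq * cantor_seq |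
    exists N, forall n, (N <= n)%N -> Q (p.2 n, p.1 n)].
have -> : rs_rel (reaping_relsys code) =
  (fst @^-1` range (code_seq code) `&`
   snd @^-1` (code_seq code @` [set g | ~ Fin B g]) `&` (ev L `|` ev P))%classic.
  apply/seteqP; split=> [_ [[f g] /= [ginf r] <-]|].
    split; first by split; [exists f|exists g].
    by case: r => [/qclass_le|/qclass_disj] [N NP]; [left|right];
      exists N => n /NP; [move/le_mem|move/disj_mem].
  move=> [_ _] [[[f _ /= <-] [g /= ginf <-]] fg]; exists (f, g) => //=; split=> //.
  by case: fg => -[N NP]; [left; apply/qclass_le|right; apply/qclass_disj];
    exists N => n /NP; [move/le_mem|move/disj_mem].
have bev Q : borel Q -> borel (ev Q).
  move=> bQ; apply: borel_eventually => n.
  apply: (@continuous_borel_fun _ _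
    (fun p : cantor_seq * cantor_seq => (p.2 n, p.1 n)) _ Q) => //.
  apply: pair_continuous => p.
    by apply: (@continuous_comp _ _ _ snd) (@proj_cts n _); exact: cvg_snd.
  by apply: (@continuous_comp _ _ _ fst) (@proj_cts n _); exact: cvg_fst.
apply: borelI; last by apply: borelU; apply: bev; case: codeB.
apply: borelI.
  by apply: (continuous_borel_fun _ borel_chal) => x; exact: cvg_fst.
by apply: (continuous_borel_fun _ borel_resp) => x; exact: cvg_snd.
Qed.

Lemma reaping_borel_relsys (R : realType) : borel_relsys R (reaping_relsys code).
Proof.
split=> /=.
- exact: cantor_seq_polish.
- by split; [exact: borel_chal|exact: borel_rel|exact: borel_resp].
(* A challenge outside [Fin] is reaped by itself; one in [Fin] is reaped by its complement. *)
- move=> _ [f _ <-]; have [finf|/contrapT ffin] := pselect (~ Fin B f).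
    by exists (code_seq code f); [exists f|exists (f, f) => //; split=> //; left].
  have cinf : ~ Fin B (~` f).
    move=> cfin; have := FinU ffin cfin; rewrite joinxC.
    move=> /(FinP (B:=B))[N /(_ N (leqnn N))].
    by move=> topN; case: codeB => /eqP[].
  exists (code_seq code (~` f)); first by exists (~` f).
  exists (f, ~` f) => //; split=> //=; right.
  by rewrite qclassC meetC meetxC.
- move=> _ [g ginf <-]; have [f nr] := split_not_reaped ginf.
  exists (code_seq code f); first by exists f.
  by move=> [[f' g'] /= [_ r] [/code_seq_inj ff' /code_seq_inj gg']]; apply: nr;
    rewrite -ff' -gg'.
Qed.

End reaping_borel.

(** * Bases of ultrafilters on the reduced power *)

Lemma countable_enum (T : Type) (D : set T) : countable D -> D !=set0 ->
  exists e : nat -> T, (forall i, D (e i)) /\ forall x, D x -> exists i, e i = x.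
Proof.
move=> /countable_injP[f finj] [x0 Dx0].
have /choice[e eP] i : exists x, D x /\ ((exists2 y, D y & f y = i) -> f x = i).
  have [[y Dy fy]|ny] := pselect (exists2 y, D y & f y = i); first by exists y.
  by exists x0; split=> // /ny.
exists e; split=> [i|x Dx]; first by case: (eP i).
have [De feq] := eP (f x).
by exists (f x); apply: finj; rewrite ?inE //; apply: feq; exists x.
Qed.

Section ultrafilter_bases.
Variables (d : Order.disp_t) (B : ctbDistrLatticeType d).

(** A nonzero [p] below a countable base would reap every [f], because [U] decides [f] and so some
    base element lies below [f] or its complement. This contradicts [split_not_reaped]. *)
Lemma ultrafilter_base_uncountable (U D : set (reduced_power B)) :
  boolalg_ultrafilter U -> D `<=` U ->
  (forall x, U x -> exists2 y, D y & y <= x) -> ~ countable D.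
Proof.
move=> [U1 nU0 Uup UI Uultra] DU Dcof cD.
have [|e [De eD]] := countable_enum cD.
  by have [y Dy _] := Dcof _ U1; exists y.
have /choice[v vE] i : exists f, qclass (Fin B) f = e i by exact: qclass_surj.
have Uv k : U (qclass (Fin B) (fmeet v k)).
  elim: k => [|k IH] /=; first by rewrite vE; exact/DU.
  by rewrite qclassI; apply: UI => //; rewrite vE; exact/DU.
have [k /qclass_eq0 f0|p pinf pv] := @pseudo_intersection _ _ v.
  by apply: nU0; rewrite -f0.
have [f nfp] := split_not_reaped pinf; apply: nfp.
have pD y : D y -> qclass (Fin B) p <= y by move=> /eD[i <-]; rewrite -vE.
have [/Dcof[y Dy yf]|/Dcof[y Dy yf]] := Uultra (qclass (Fin B) f).
  by left; exact: le_trans (pD y Dy) yf.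
right; apply/eqP; rewrite disj_leC; exact: le_trans (pD y Dy) yf.
Qed.

(** Turns uncountability of bases into non-principality. *)
Lemma principal_base (U : set (reduced_power B)) :
  principal U -> exists2 D : set (reduced_power B),
    countable D & D `<=` U /\ forall x, U x -> exists2 y, D y & y <= x.
Proof.
move=> [a ->]; exists [set a]; first exact: countable1.
by split=> [_ -> /=|x ax]; [|exists a].
Qed.

(** The upward closure of the tower is a filter because the tower is decreasing, and an ultrafilter
    because every [c] is reaped. The tower itself is a base. *)
Lemma ultrafilter_number_tower (u : omega1 -> reduced_power B) :
  (forall x, u x != \bot) -> (forall x y, x <= y -> u y <= u x) ->
  (forall c, exists x, reaps c (u x)) ->
  ultrafilter_number_is (reduced_power B) [set: omega1].
Proof.
move=> u0 udec ureap; pose U := [set z | exists x, u x <= z].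
have Uuf : boolalg_ultrafilter U.
  split.
  - by have [x _] := ureap \top; exists x; exact: lex1.
  - by move=> [x]; rewrite lex0 (negbTE (u0 x)).
  - by move=> y z [x xy] yz; exists x; exact: le_trans xy yz.
  - move=> y z [x xy] [x' xz]; exists (Order.max x x').
    by rewrite lexI (le_trans (udec _ _ _) xy) ?(le_trans (udec _ _ _) xz) //
      le_max lexx ?orbT.
  - move=> c; have [x [xc|/eqP]] := ureap c; first by left; exists x.
    by rewrite disj_leC => xc; right; exists x.
have lower (V D : set (reduced_power B)) : boolalg_ultrafilter V -> D `<=` V ->
    (forall x, V x -> exists2 y, D y & y <= x) -> [set: omega1] #<= D.
  move=> Vuf DV Dcof; apply: omega1_card_le.
  exact: ultrafilter_base_uncountable Vuf DV Dcof.
split.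
  exists U.
    split=> // /principal_base[D cD [DU Dcof]].
    exact: ultrafilter_base_uncountable Uuf DU Dcof cD.
  have Dcof : (range u `<=` U) /\ forall x, U x -> exists2 y, range u y & y <= x.
    split=> [_ [x _ <-]|z [x xz]]; first by exists x.
    by exists (u x) => //; exists x.
  split=> [|D [DU Dc]]; last exact: lower Uuf DU Dc.
  exists (range u) => //; rewrite card_eq_le card_image_le /=.
  by apply: lower Uuf _ _; case: Dcof.
move=> V K [Vuf _] [[D [DV Dcof] DK] _].
by rewrite -(card_le_eqr DK); exact: lower Vuf DV Dcof.
Qed.

End ultrafilter_bases.

(** * Construction of the reaping tower from the diamond principle *)

Section tower.
Variables (d : Order.disp_t) (B : ctbDistrLatticeType d).
Variable code : B -> cantor_space.
Hypothesis codeH : borel_homogeneous code.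

Let codeB : borel_boolalg code. Proof. by case: codeH. Qed.

(* [psi b] inverts an isomorphism of the relative algebra below [b] onto [B],
   and [phi b c] is the image of the trace of [c] under that isomorphism. *)
Lemma relative_transfer : exists phi psi : B -> B -> B, forall b, b != \bot ->
  [/\ forall y, psi b y <= b, forall y, psi b y = \bot -> y = \bot,
      forall y c, y <= phi b c -> psi b y <= c &
      forall y c, y `&` phi b c = \bot -> psi b y `&` c = \bot].
Proof.
have /choice[pp ppP] b : exists p : (B -> B) * (B -> B), b != \bot ->
    [/\ forall y, p.2 y <= b, forall y, p.2 y = \bot -> y = \bot,
        forall y c, y <= p.1 c -> p.2 y <= c &
        forall y c, y `&` p.1 c = \bot -> p.2 y `&` c = \bot].
  have [->|b0] := eqVneq b \bot; first by exists (id, id).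
  have [_ _ /(_ b b0)[h [[k hK kK] hI _ _ [h0 _]] _]] := codeH.
  pose tr c : relative_algebra b := exist _ (c `&` b) (leIr _ _).
  exists (fun c => h (tr c), fun y => val (k y)) => _ /=; split.
  - by move=> y; exact: (valP (k y)).
  - move=> y ky; rewrite -[y]kK -h0; congr h; exact: val_inj.
  - move=> y c; rewrite leEmeet -{1 2}[y]kK -hI => /eqP/(can_inj hK)/(congr1 val) /= E.
    by rewrite -E meetA leIxl // leIr.
  - move=> y c yc; have : h (k y `&` tr c) = h \bot by rewrite hI kK yc h0.
    move=> /(can_inj hK)/(congr1 val) /= <-.
    rewrite meetA [RHS]meet_l //; exact: le_trans (leIl _ _) (valP (k y)).
exists (fun b => (pp b).1), (fun b => (pp b).2); exact: ppP.
Qed.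

(** Levels are representatives rather than classes, since the construction works at single
    coordinates. *)
Lemma reaping_tower : diamond (reaping_relsys code) ->
  exists u : omega1 -> nat -> B, [/\ forall x, ~ Fin B (u x),
    forall x y, x < y -> qclass (Fin B) (u y) <= qclass (Fin B) (u x) &
    forall c, exists x, reaps (qclass (Fin B) c) (qclass (Fin B) (u x))].
Proof.
move=> dia; have [phi [psi tr]] := relative_transfer.
have [x0 x0P] := omega1_least.
have [e [beta [e_inj e_lt]]] := omega1_seq_code x0.
have /choice[en enP] (a : omega1) : exists en : nat -> omega1, x0 < a ->
    (forall i, en i < a) /\ forall y, y < a -> exists i, en i = y.
  have [x0a|_] := boolP (x0 < a); last by exists (fun=> x0).
  have [|s sP] := countable_enum (omega1_countable_segment a).
    by exists x0.
  by exists s.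
(* Bit [(k, j)] is read at the code of [en a 0, ..., en a k] and [j]. It depends on at most one
   coordinate of [t], whence continuity; the default [false] does not occur when [a] is above [x0]
   and closed under [beta]. *)
pose dec a (t : two_pow a) : cantor_seq := fun k j =>
  if pselect (e (mkseq (en a) k.+1, j) < a) is left H
  then t (exist (fun b : omega1 => is_true (b < a)) _ H) else false.
have dec_cts a : continuous (@dec a).
  apply: prod_topology_continuous => k; apply: prod_topology_continuous => j.
  rewrite /dec; case: pselect => [H|_]; last by move=> t; exact: cvg_cst.
  exact: (@proj_continuous _ (fun _ : {b : omega1 | b < a} => bool)).
pose F a (t : two_pow a) : cantor_seq :=
  if pselect (range (code_seq code) (dec a t)) then dec a t
  else code_seq code \bot.
have F_borel a : borel_fun (F a).
  move=> C bC; pose E := @dec a @^-1` range (code_seq code).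
  have bE : borel E by exact: (continuous_borel_fun (dec_cts a) (borel_chal codeB)).
  have bdC : borel (@dec a @^-1` C) by exact: (continuous_borel_fun (dec_cts a) bC).
  (* On the Borel set [E] of well-formed inputs [F a] is [dec a]; off [E] it is constant. *)
  have -> : F a @^-1` C = ((@dec a @^-1` C `&` E) `|`
      (~` E `&` [set t | C (code_seq code \bot)]))%classic.
    apply/seteqP; split=> t; rewrite /F /preimage /=; case: pselect => Et.
    - by left.
    - by right.
    - by case=> -[].
    - by case=> -[].
  apply: borelU; first exact: borelI.
  apply: borelI; first exact: borelC.
  have [C0|nC0] := pselect (C (code_seq code \bot)).
    rewrite (_ : [set _ | _] = setT); first exact: borelT.
    by apply/seteqP; split.
  rewrite (_ : [set _ | _] = set0); first exact: sigma_algebra0.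
  by apply/seteqP; split.
have [a t|g gresp gP] := dia F F_borel.
  by rewrite /F; case: pselect => //; exists \bot.
have /choice[gam gamP] a : exists f, ~ Fin B f /\ code_seq code f = g a.
  by have [f finf fE] := gresp a; exists f.
pose pt v k := fmeet v k (diag v k) : B.
have [u uE] := omega1_recursion (\top : nat -> B) (fun a w =>
  let v i := w (en a i) in spread (diag v) (fun k => psi (pt v k) (gam a k))).
(* The history visible at stage [a]; at the least stage it is [\top] throughout. *)
pose w a y := if y < a then u y else \top.
have {}uE a : u a = let v i := w a (en a i) in
  spread (diag v) (fun k => psi (pt v k) (gam a k)) by exact: uE.
have inv a : [/\ forall k, ~ Fin B (fmeet (fun i => w a (en a i)) k),
    ~ Fin B (u a) &
    forall y, y < a -> qclass (Fin B) (u a) <= qclass (Fin B) (u y)].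
  elim/(well_founded_ind omega1_wf): a => a IH.
  rewrite uE; set v := (fun i => w a (en a i)); cbv zeta.
  have wP y y' : exists z, qclass (Fin B) (w a z) <= qclass (Fin B) (w a y) /\
      qclass (Fin B) (w a z) <= qclass (Fin B) (w a y').
    rewrite /w; have [ya|_] := boolP (y < a); last by exists y'; split=> //; exact: lex1.
    have [y'a|_] := boolP (y' < a); last by exists y; rewrite ya; split=> //; exact: lex1.
    case: (ltgtP y y') => [yy'|y'y|->]; [exists y'|exists y|exists y'].
    - by rewrite y'a; split=> //; have [_ _] := IH _ y'a; exact.
    - by rewrite ya; split=> //; have [_ _] := IH _ ya; exact.
    - by rewrite y'a.
  have winf y : ~ Fin B (w a y).
    rewrite /w; case: ifP => [/IH[]//|_] /FinP[N /(_ N (leqnn N)) topN].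
    by case: codeB => /eqP[].
  have vinf k : ~ Fin B (fmeet v k).
    (* By [wP] the visible levels are directed downwards, so a single one lies below any finite
       meet. *)
    have [y yk] : exists y, qclass (Fin B) (w a y) <= qclass (Fin B) (fmeet v k).
      elim: k => [|k [y yk]]; first by exists (en a 0%N).
      have [z [zy zk]] := wP y (en a k.+1); exists z => /=.
      by rewrite qclassI lexI (le_trans zy yk).
    move=> /qclass_eq0 f0; apply: (winf y); apply/qclass_eq0.
    by apply/eqP; rewrite -lex0 -f0.
  have dI := diag_inj vinf.
  have pt0 k : pt v k != \bot by case: (diag_spec vinf k).
  split=> //.
    apply/NFinP => N; have [ginf _] := gamP a.
    have /NFinP/(_ N)[k Nk gk] := ginf.
    exists (diag v k); first exact: leq_trans Nk (diag_ge vinf k).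
    rewrite spreadE //; apply: contraNneq gk => /eqP; have [_ psi0 _ _] := tr _ (pt0 k).
    by move=> /eqP/psi0 ->.
  move=> y ya; have x0a : x0 < a by exact: le_lt_trans (x0P y) ya.
  have [i yE] := (enP a x0a).2 y ya.
  apply/qclass_le; exists (diag v i) => n.
  case: (spreadP (diag v) (fun k => psi (pt v k) (gam a k)) n) => [->|[k <- ->]].
    by rewrite le0x.
  rewrite (diag_le vinf) => ik; have [psi_le _ _ _] := tr _ (pt0 k).
  apply: le_trans (psi_le _) _; apply: le_trans (fmeet_le v _ ik) _.
  by rewrite /v /w yE ya.
exists u; split=> [x|x y xy|c]; [by case: (inv x)|by have [_ _] := inv y; exact|].
(* Indexed by finite sequences and not by stages, so that one [f] serves all [a]. For
   [s = mkseq (en a) k.+1] the index is [k], and only entries of [s] up to [k] matter. *)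
pose Dc (s : seq omega1) : B :=
  let v i := u (nth x0 s i) in let k := (size s).-1 in
  phi (pt v k) (c (diag v k)).
pose f z := `[< exists p, e p = z /\ code (Dc p.1) p.2 >].
have fE p : f (e p) = code (Dc p.1) p.2.
  by apply/asboolP/idP => [[q [/e_inj ->]]//|cp]; exists p.
(* Meeting this club ensures that all codes read at stage [a] lie below [a]. *)
have [a [x0a aP] [[y ga] [_ /= r] /= yg]] := gP f _ (club_closure_points x0 beta).
exists a.
have [en_lt en_surj] := enP a x0a.
pose v i := u (en a i).
have decE : dec a (seg_restr f a) = code_seq code (fun k => Dc (mkseq (en a) k.+1)).
  apply/funext => k; apply/funext => j; rewrite /dec; case: pselect => [H|[]].
    by rewrite /seg_restr /= fE.
  apply: e_lt => //; apply/allP => z /mapP[i _ ->]; exact: en_lt.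
have DcE k : Dc (mkseq (en a) k.+1) = phi (pt v k) (c (diag v k)).
  have vE i : (i <= k)%N -> u (nth x0 (mkseq (en a) k.+1) i) = v i.
    by move=> ik; rewrite nth_mkseq.
  by rewrite /Dc size_mkseq /pt /= (eq_fmeet vE) (eq_diag vE).
have vE : (fun i => w a (en a i)) = v by apply/funext => i; rewrite /w en_lt.
have [+ _ _] := inv a; rewrite vE => vinf.
have pt0 k : pt v k != \bot by case: (diag_spec vinf k).
have {}uE : u a = spread (diag v) (fun k => psi (pt v k) (gam a k)).
  by rewrite uE vE.
case: yg => yF /= gaE.
have {}gaE : ga = gam a by apply: (code_seq_inj codeB); rewrite gaE; case: (gamP a).
(* The decoded sequence is the code of an element of the power, so [F] applies no correction. *)
have {}yF : y = (fun k => phi (pt v k) (c (diag v k))).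
  apply: (code_seq_inj codeB); rewrite yF /F decE; case: pselect => [?|nr].
    by congr code_seq; apply/funext.
  by case: nr; eexists.
(* Coordinates [diag v k] from [diag v N] on are those with [k >= N], where [psi] carries the
   inequality or disjointness back to [c]; elsewhere [u a] is 0. *)
case: r => [/qclass_le|/qclass_disj] [N NP];
  [left; apply/qclass_le|right; apply/qclass_disj];
  exists (diag v N) => n; rewrite uE;
  case: (spreadP (diag v) (fun k => psi (pt v k) (gam a k)) n) => [->|[k <- ->]];
  rewrite ?le0x ?meet0x // (diag_le vinf) => /NP; rewrite gaE yF;
  by have [_ _] := tr _ (pt0 k); auto.
Qed.

End tower.

Theorem theorem5p5 (R : realType) (d : Order.disp_t)
    (B : ctbDistrLatticeType d) (code : B -> cantor_space) :
  (borel_boolalg code -> borel_relsys R (reaping_relsys code)) /\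
  (borel_homogeneous code ->
     diamond (reaping_relsys code) ->
     ultrafilter_number_is (reduced_power B) [set: omega1]%classic).
Proof.
split=> [codeB|codeH /(reaping_tower codeH)[u [uinf udec ureap]]].
  exact: reaping_borel_relsys.
apply: (@ultrafilter_number_tower _ _ (fun x => qclass (Fin B) (u x))).
- by move=> x; apply/eqP => /qclass_eq0; exact: uinf.
- by move=> x y; rewrite le_eqVlt => /orP[/eqP ->|/udec].
- by move=> c; have [f <-] := qclass_surj c; exact: ureap.
Qed.
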